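(* Let $x(t+1)=Ax(t)+\sum_{i=1}^mB_iu_i(t)$, $y_i(t)=C_ix(t)$ be an $n$-dimensional, jointly controllable and jointly observable $m$-channel discrete-time linear system whose neighbor graph is weakly connected, with time-invariant integer transmission delays $d_{ij}\ge0$ from agent $i$ to each follower $j$ of $i$ ($d_{ii}=0$), and let $d_i=\max_{j\in\mathcal{F}_i}d_{ij}$. Let nonnegative integers $n_1,\dots,n_m$ be given, let $N_z=\sum_{k}(d_k+1)n_k$ and $\tilde n=n+N_z$. For $0\le\delta\le d_i$ let $H_{i\delta}$ be the $N_z\times n_i$ block column matrix, partitioned into blocks of sizes $(d_1+1)n_1,\dots,(d_m+1)n_m$, whose $k$th block is zero for $k\ne i$ and whose $i$th block is $\mathrm{column}\{\mathbf{0}_{\delta n_i\times n_i},I_{n_i},\mathbf{0}_{(d_i-\delta)n_i\times n_i}\}$. Define the extended system $\{\tilde A,\tilde B_i,\tilde C_i;m\}$ by $$\tilde A=\mathrm{blockdiag}\Big\{A,\ \begin{bmatrix}0&\mathbf{0}_{n_1}\\ I_{d_1n_1}&0\end{bmatrix},\dots,\begin{bmatrix}0&\mathbf{0}_{n_m}\\ I_{d_mn_m}&0\end{bmatrix}\Big\},\quad \tilde B_i=\begin{bmatrix}B_i&0\\0&H_{i0}\end{bmatrix},\quad \tilde C_i=\begin{bmatrix}C_i&0\\0&H_{j_1d_{j_1i}}'\\ \vdots&\vdots\\0&H_{j_{m_i}d_{j_{m_i}i}}'\end{bmatrix},$$ where $\mathcal{N}_i=\{j_1,\dots,j_{m_i}\}$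 and the $k$th diagonal block after $A$ is the $(d_k+1)n_k\times(d_k+1)n_k$ block shift matrix (zero first block row, $I_{d_kn_k}$ in the lower-left position). (This models local controllers $z_i(t+1)=v_i(t)$ with state $\mathrm{column}\{x(t),z_1(t),\dots,z_1(t-d_1),\dots,z_m(t),\dots,z_m(t-d_m)\}$, inputs $\mathrm{column}\{u_i,v_i\}$, and agent $i$ measuring $y_i(t)$ and $z_j(t-d_{ji})$, $j\in\mathcal{N}_i$.) Suppose $$n_i\ \ge\ n-\min_{\mathbf{s}\subset\{1,\dots,m\},\ \lambda\in\sigma(A)}\mathrm{rank}\begin{bmatrix}\lambda I_n-A & B_{\mathbf{s}}\\ C_{\{1,\dots,m\}-\mathbf{s}}&0\end{bmatrix}\quad\text{for all } i.$$ Then for any nonzero complex number $\lambda$: $\lambda$ is not a fixed eigenvalue of $\{\tilde A,\tilde B_i,\tilde C_i;m\}$ if and only if $\mathcal{N}_{\{1,\dots,m\}-\mathbf{s}}\cap\mathbf{s}\neq\emptyset$ for every subset $\mathbf{s}\subset\{1,\dots,m\}$ with $\mathrm{rank}\begin{bmatrix}\lambda I_n-A&B_{\mathbf{s}}\\C_{\{1,\dots,m\}-\mathbf{s}}&0\end{bmatrix}<n$.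
   Context: Jointly controllable: $(A,[B_1\ \cdots\ B_m])$ controllable; jointly observable: $(\mathrm{column}\{C_1,\dots,C_m\},A)$ observable. The neighbor graph is a directed graph on $\{1,\dots,m\}$ with an arc $j\to i$ iff $j$ is a neighbor of $i$ (agent $i$ receives information from $j$); $\mathcal{N}_i$ is the set of neighbors of $i$ including $i$, $\mathcal{N}_{\mathbf{s}}=\bigcup_{i\in\mathbf{s}}\mathcal{N}_i$. Agent $j$ is a follower of agent $i$ if $j$ receives information from $i$ (i.e., $i\in\mathcal{N}_j$); $\mathcal{F}_i$ is the set of followers of $i$ including $i$. Weakly connected: removing self-arcs and replacing arcs by undirected edges yields a connected graph. $B_{\mathbf{s}}=[B_{i_1}\ \cdots\ B_{i_s}]$, $C_{\mathbf{s}}=\mathrm{column}\{C_{i_1},\dots,C_{i_s}\}$ for $\mathbf{s}=\{i_1<\dots<i_s\}$. A fixed eigenvalue of an $m$-channel system $\{A,B_i,C_i;m\}$ is an eigenvalue of $A+\sum_iB_iF_iC_i$ that does not change as the real matrices $F_i$ range over all values. *)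

(* Defs.v *)
From HB Require Import structures.
From mathcomp Require Import all_boot all_order all_algebra.
From mathcomp Require Import complex.
Set Implicit Arguments. Unset Strict Implicit. Unset Printing Implicit Defensive.
Import Order.TTheory GRing.Theory Num.Theory.
Local Open Scope ring_scope.

Section Defs.
Variable R : rcfType.
Local Notation C := (R[i]).

Definition cmx (a b : nat) (M : 'M[R]_(a, b)) : 'M[C]_(a, b) :=
  map_mx (real_complex R) M.

Definition controllable (n p : nat) (A : 'M[R]_n) (B : 'M[R]_(n, p)) : bool :=
  \rank (\mxrow_(k < n) (A ^+ k *m B)) == n.
Definition observable (n q : nat) (Cm : 'M[R]_(q, n)) (A : 'M[R]_n) : bool :=
  \rank (\mxcol_(k < n) (Cm *m A ^+ k)) == n.

Variable m : nat.

(* nbr i j  <=>  j is a neighbor of i (agent i receives information from j). *)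
Definition Nset (nbr : rel 'I_m) (i : 'I_m) : {set 'I_m} :=
  [set j | (j == i) || nbr i j].
Definition Fset (nbr : rel 'I_m) (i : 'I_m) : {set 'I_m} :=
  [set j | i \in Nset nbr j].
Definition NsetS (nbr : rel 'I_m) (s : {set 'I_m}) : {set 'I_m} :=
  \bigcup_(i in s) Nset nbr i.

Definition weakly_connected (nbr : rel 'I_m) : Prop :=
  forall i j : 'I_m, connect (fun a b => (a != b) && (nbr a b || nbr b a)) i j.

Definition Bs (n : nat) (p : 'I_m -> nat) (B : forall i, 'M[R]_(n, p i))
  (s : {set 'I_m}) := \mxrow_(k < #|s|) B (enum_val k).
Definition Cs (n : nat) (q : 'I_m -> nat) (Cm : forall i, 'M[R]_(q i, n))
  (s : {set 'I_m}) := \mxcol_(k < #|s|) Cm (enum_val k).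

Definition rank_test (n : nat) (A : 'M[R]_n) (p q : 'I_m -> nat)
  (B : forall i, 'M[R]_(n, p i)) (Cm : forall i, 'M[R]_(q i, n))
  (lam : C) (s : {set 'I_m}) : nat :=
  \rank (block_mx (lam%:M - cmx A) (cmx (Bs B s)) (cmx (Cs Cm (~: s))) 0).

Definition fixed_eig (N : nat) (A : 'M[R]_N) (p q : 'I_m -> nat)
  (B : forall i, 'M[R]_(N, p i)) (Cm : forall i, 'M[R]_(q i, N)) (lam : C) : Prop :=
  forall F : forall i, 'M[R]_(p i, q i),
    eigenvalue (cmx (A + \sum_(i < m) B i *m F i *m Cm i)) lam.

Section Ext.
Variables (nbr : rel 'I_m) (d : 'I_m -> 'I_m -> nat) (nk : 'I_m -> nat).

Definition dmax (i : 'I_m) : nat := \max_(j in Fset nbr i) d i j.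
Definition blk (k : 'I_m) : nat := ((dmax k).+1 * nk k)%N.
Definition Nz : nat := (\sum_(k < m) blk k)%N.

(* (d+1)r x (d+1)r block shift: zero first block row, I_{dr} lower-left *)
Definition shift_mx (d0 r : nat) : 'M[R]_(d0.+1 * r) :=
  \matrix_(a, b) ((a : nat) == (b + r)%N)%:R.

Definition Zext : 'M[R]_Nz := \mxdiag_(k < m) shift_mx (dmax k) (nk k).

Definition Hmx (i : 'I_m) (delta : nat) : 'M[R]_(Nz, nk i) :=
  \mxcol_(k < m) (\matrix_(a < blk k, b < nk i)
     ((k == i) && ((a : nat) == (delta * nk i + b)%N))%:R : 'M[R]_(blk k, nk i)).

Variables (n : nat) (A : 'M[R]_n) (p q : 'I_m -> nat)
  (B : forall i, 'M[R]_(n, p i)) (Cm : forall i, 'M[R]_(q i, n)).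

Definition Aext : 'M[R]_(n + Nz) := block_mx A 0 0 Zext.
Definition pext (i : 'I_m) : nat := (p i + nk i)%N.
Definition Bext (i : 'I_m) : 'M[R]_(n + Nz, pext i) :=
  block_mx (B i) 0 0 (Hmx i 0).
Definition qext (i : 'I_m) : nat :=
  (q i + \sum_(k < #|Nset nbr i|) nk (enum_val k))%N.
Definition Cext (i : 'I_m) : 'M[R]_(qext i, n + Nz) :=
  col_mx (row_mx (Cm i) 0)
    (row_mx 0 (\mxcol_(k < #|Nset nbr i|)
                 (Hmx (enum_val k) (d (enum_val k) i))^T)).
End Ext.
End Defs.

(* Main.v *)
Require Import Defs.
From HB Require Import structures.
From mathcomp Require Import all_boot all_order all_algebra.
From mathcomp Require Import complex.
Import Order.TTheory GRing.Theory Num.Theory.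
Local Open Scope ring_scope.

(* The generic rank of X + sum_i B_i G_i C_i over all feedback gains G is the
   minimum over s of rank [X, B_s; C_{~s}, 0]: with one channel, a rank-one
   update raises the rank as long as neither bound is met, and one gain can be
   chosen simultaneously for all the pencils left by the other channels, the
   bad points on a line being the roots of finitely many polynomials. Hence
   lam is a fixed eigenvalue iff one of these pencils has rank < n.
   For the extended system lam - Z is invertible when lam != 0, so a Schur
   complement shows that its pencil for s has rank
     rank_test(s) + N_z + rank T_s(lam),
   where T_s is the transfer matrix from the v_i, i in s, to the relayed z's seen
   outside s. The entry of T_s from v_i to z_k(t - e) is lam^-(e+1) I if i = k
   and 0 otherwise, so T_s(lam) vanishes when N_{~s} misses s, and has rank at
   least n_k when k lies in both. *)

Set Implicit Arguments. Unset Strict Implicit. Unset Printing Implicit Defensive.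

(** * Generic rank along lines and under feedback in one channel *)

Section GenericRank.
Variables (F : numFieldType) (K : fieldType) (f : {rmorphism F -> K}).

(** [F] has characteristic zero and [f] is injective, so [size g] naturals have distinct images,
    more than [g] has roots. Gains can thus stay in [F] while the polynomials live over [K]. *)
Lemma exists_nonroot (g : {poly K}) : g != 0 -> exists t : F, g.[f t] != 0.
Proof.
move=> g0; pose rs := [seq f k%:R | k <- iota 0 (size g)].
have: ~~ all (root g) rs.
  apply/negP => /(max_poly_roots g0) H.
  have /H : uniq rs.
    rewrite map_inj_uniq ?iota_uniq // => i j /fmorph_inj/eqP.
    by rewrite eqr_nat => /eqP.
  by rewrite size_map size_iota ltnn.
by case/allPn => _ /mapP[k _ ->] H; exists k%:R.
Qed.

(** One-sided inverses [P] and [Q] of the factors of a rank factorization of [A] compress the line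
    to a square matrix of order [\rank A], equal to the identity at [t0]. Its determinant [g] is
    therefore nonzero, and the rank stays at least [\rank A] wherever [g] does not vanish. *)
Lemma rank_line_generic a b r (M N : 'M[K]_(a, b)) t0 :
  (r <= \rank (M + t0 *: N)%R)%N ->
  exists2 g : {poly K}, g != 0 &
    forall t, g.[t] != 0 -> (r <= \rank (M + t *: N)%R)%N.
Proof.
set A : 'M_(a, b) := M + t0 *: N => rA.
pose P := pinvmx (col_base A); pose Q := pinvmx (row_base A).
pose h t := P *m (M + t *: N) *m Q.
pose g := \det (map_mx polyC (P *m M *m Q) + 'X *: map_mx polyC (P *m N *m Q)).
have gE t : g.[t] = \det (h t).
  rewrite -[LHS]/(horner_eval t _) -det_map_mx; congr (\det _).
  apply/matrixP => i j; rewrite /h mulmxDr mulmxDl -scalemxAr -scalemxAl.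
  by rewrite !mxE /= /horner_eval !hornerE.
have ht0 : h t0 = 1%:M.
  transitivity (P *m (col_base A *m row_base A) *m Q); first by rewrite mulmx_base.
  rewrite [P *m (_ *m _)]mulmxA /P mulVpmx ?col_base_full // mul1mx.
  by rewrite mulmxVp ?row_base_free.
exists g.
  by apply: contra_neq (oner_neq0 K) => g0; rewrite -(det1 K (\rank A)) -ht0 -gE g0 horner0.
move=> t; rewrite gE -unitfE -unitmxE => /mxrank_unit rh; apply: leq_trans rA _.
by rewrite -rh (leq_trans (mxrankM_maxl _ _)) ?mxrankM_maxr.
Qed.

Lemma ranks_line_generic (J : eqType) (l : seq J) (r : J -> nat) a b
    (M N : J -> 'M[K]_(a, b)) :
  (forall j, j \in l -> exists t, (r j <= \rank (M j + t *: N j)%R)%N) ->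
  exists2 g : {poly K}, g != 0 &
    forall j t, j \in l -> g.[t] != 0 -> (r j <= \rank (M j + t *: N j)%R)%N.
Proof.
elim: l => [|j l IH] H; first by exists 1 => //; rewrite oner_eq0.
have [|g g0 Hg] := IH; first by move=> i il; apply: H; rewrite inE il orbT.
have [|t /rank_line_generic[h h0 Hh]] := H j; first exact: mem_head.
exists (g * h) => [|i {}t]; first by rewrite mulf_neq0.
rewrite inE hornerM mulf_eq0 negb_or => /predU1P[->|il] /andP[gt ht].
  exact: Hh.
exact: Hg.
Qed.

(** With [G0] good for the tail and [G1] for the head, each bound is reached on the line through
    them, at 0 or at 1. All bounds then hold off the roots of a single polynomial. *)
Lemma common_feedback (J : eqType) (l : seq J) (r : J -> nat) a b p q
    (M : J -> 'M[K]_(a, b)) (U : 'M[K]_(a, p)) (V : 'M[K]_(q, b)) :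
  (forall j, j \in l ->
     exists G : 'M[F]_(p, q), (r j <= \rank (M j + U *m map_mx f G *m V)%R)%N) ->
  exists G : 'M[F]_(p, q), forall j, j \in l ->
    (r j <= \rank (M j + U *m map_mx f G *m V)%R)%N.
Proof.
elim: l => [|j l IH] H; first by exists 0.
have [|G0 H0] := IH; first by move=> i il; apply: H; rewrite inE il orbT.
have [|G1 H1] := H j; first exact: mem_head.
have lineE i t : M i + U *m map_mx f (G0 + t *: (G1 - G0)) *m V
    = (M i + U *m map_mx f G0 *m V) + f t *: (U *m map_mx f (G1 - G0) *m V).
  by rewrite map_mxD map_mxZ mulmxDr mulmxDl addrA -scalemxAr -scalemxAl.
have [i|g g0 Hg] := @ranks_line_generic _ (j :: l) r _ _
   (fun i => M i + U *m map_mx f G0 *m V)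
   (fun i => U *m map_mx f (G1 - G0) *m V).
  rewrite inE => /predU1P[->|il]; [exists (f 1) | exists (f 0)]; rewrite -lineE.
    by rewrite scale1r subrKC H1.
  by rewrite scale0r addr0 H0.
have [t gt] := exists_nonroot g0.
by exists (G0 + t *: (G1 - G0)) => i il; rewrite lineE Hg.
Qed.

(** Since [v] is outside the row space of [M], some [x] has [M *m x = 0] and [v *m x = 1]. Then
    [N *m x = u], so the column space of [N] contains [u] and hence that of [M], strictly because
    [u] is not in the latter. *)
Lemma rank_add_outer a b (M : 'M[K]_(a, b)) (u : 'cV_a) (v : 'rV_b) :
  ~~ (u^T <= M^T)%MS -> ~~ (v <= M)%MS -> (\rank M < \rank (M + u *m v)%R)%N.
Proof.
move=> uM vM; rewrite -mxrank_tr -[leqRHS]mxrank_tr; set N := M + _.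
have uN : (u^T <= N^T)%MS.
  have /rV0Pn[k w0] : v *m cokermx M != 0 by rewrite -submxE.
  set w := v *m cokermx M in w0.
  pose x := (w 0 k)^-1 *: col k (cokermx M).
  have vx : v *m x = 1%:M.
    rewrite -scalemxAr colE mulmxA -/w -colE [col k w]mx11_scalar [col k w 0 0]mxE.
    by rewrite scale_scalar_mx mulVf.
  have -> : u = N *m x; last by rewrite trmx_mul submxMl.
  rewrite mulmxDl -mulmxA vx mulmx1.
  by rewrite -scalemxAr colE mulmxA mulmx_coker mul0mx scaler0 add0r.
suff: (M^T < N^T)%MS by rewrite ltmxErank => /andP[].
rewrite ltmxE; apply/andP; split; last by apply: contra uM; apply: submx_trans.
have -> : M^T = N^T - v^T *m u^T by rewrite -trmx_mul -linearB addrK.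
by rewrite addmx_sub // eqmx_opp (submx_trans _ uN) ?submxMl.
Qed.

(** If the inductive gain gives rank exactly [r], the two bounds leave a column of [U] outside the
    column space of [M'] and a row of [V] outside its row space. Changing one entry of the gain adds
    their outer product. *)
Lemma one_channel r a b p q (M : 'M[K]_(a, b)) (U : 'M[K]_(a, p)) (V : 'M[K]_(q, b)) :
  (r <= \rank (row_mx M U))%N -> (r <= \rank (col_mx M V))%N ->
  exists G : 'M[F]_(p, q), (r <= \rank (M + U *m map_mx f G *m V)%R)%N.
Proof.
elim: r => [|r IH] rU rV; first by exists 0.
have [|G] := IH (ltnW rU); first exact: ltnW.
rewrite leq_eqVlt => /predU1P[rE|]; last by exists G.
set M' := M + _ in rE.
have /row_subPn[i Ui] : ~~ (U^T <= M'^T)%MS.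
  apply: contraL rU => UM; rewrite -leqNgt rE -mxrank_tr -[leqRHS]mxrank_tr.
  rewrite tr_row_mx mxrankS // col_mx_sub UM andbT.
  have -> : M^T = M'^T - (map_mx f G *m V)^T *m U^T.
    by rewrite -trmx_mul mulmxA -linearB addrK.
  by rewrite addmx_sub // eqmx_opp mulmx_sub.
have /row_subPn[j Vj] : ~~ (V <= M')%MS.
  apply: contraL rV => VM; rewrite -leqNgt rE mxrankS // col_mx_sub VM andbT.
  have -> : M = M' - U *m map_mx f G *m V by rewrite addrK.
  by rewrite addmx_sub // eqmx_opp mulmx_sub.
exists (G + delta_mx i j); rewrite map_mxD map_delta_mx mulmxDr mulmxDl addrA -/M'.
rewrite -(mul_delta_mx (0 : 'I_1)) mulmxA -mulmxA -colE -rowE rE.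
by rewrite rank_add_outer // tr_col.
Qed.

End GenericRank.

(** * Row spaces collected over a set of channels *)

Section Span.
Variables (K : fieldType) (I : finType) (n : nat).
Implicit Types (q : I -> nat) (s t : {set I}).

(** The square shape does not depend on [s], so the pencils for all [s] share one type, as
    [common_feedback] requires. *)
Definition span_mx q (C : forall i, 'M[K]_(q i, n)) s : 'M[K]_n :=
  (\sum_(i in s) <<C i>>)%MS.

Definition tr_fam q (B : forall i, 'M[K]_(n, q i)) i : 'M[K]_(q i, n) := (B i)^T.

Lemma span_mx_sup q (C : forall i, 'M_(q i, n)) s i m (A : 'M_(m, n)) :
  i \in s -> (A <= C i)%MS -> (A <= span_mx C s)%MS.
Proof. by move=> si AC; rewrite (sumsmx_sup i) // genmxE. Qed.

Lemma span_mx_subP q (C : forall i, 'M_(q i, n)) s m (A : 'M_(m, n)) :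
  reflect (forall i, i \in s -> (C i <= A)%MS) (span_mx C s <= A)%MS.
Proof.
by apply: (iffP sumsmx_subP) => H i /H; rewrite genmxE.
Qed.

Lemma span_mx0 q (C : forall i, 'M_(q i, n)) : span_mx C set0 = 0.
Proof. exact: big_set0. Qed.

Lemma span_mxU1 q (C : forall i, 'M_(q i, n)) i s :
  (span_mx C (i |: s) <= span_mx C s + C i)%MS.
Proof.
apply/span_mx_subP => j; rewrite in_setU1 => /predU1P[->|sj].
  exact: addsmxSr.
by apply: submx_trans (addsmxSl _ _); apply: span_mx_sup sj _.
Qed.

Lemma span_mxMr q (C : forall i, 'M_(q i, n)) s m (P : 'M_(n, m)) r (A : 'M_(r, m)) :
  (forall i, i \in s -> (C i *m P <= A)%MS) -> (span_mx C s *m P <= A)%MS.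
Proof.
move=> H; rewrite sumsmxMr_gen; apply/sumsmx_subP => i /H.
by rewrite genmxE (eqmxMr _ (genmxE _)).
Qed.

Lemma span_mx_mul0 q (C : forall i, 'M_(q i, n)) s m (P : 'M_(n, m)) :
  (forall i, i \in s -> C i *m P = 0) -> span_mx C s *m P = 0.
Proof.
by move=> H; apply/eqP; rewrite -submx0; apply: span_mxMr => i /H ->; rewrite sub0mx.
Qed.

End Span.

(* Only the row spaces of [Bt] and [C] matter for the rank, so that [B] enters
   through any matrix whose rows span the column space of [B]. *)
Definition pencil_mx (K : fieldType) n b c (X : 'M[K]_n) (Bt : 'M[K]_(b, n))
    (C : 'M[K]_(c, n)) : 'M[K]_(n + c, n + b) :=
  block_mx X Bt^T C 0.

(** * Rank calculus of system pencils *)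

Section Pencil.
Variable K : fieldType.

Lemma tr_pencil n b c (X : 'M[K]_n) (Bt : 'M_(b, n)) (C : 'M_(c, n)) :
  (pencil_mx X Bt C)^T = pencil_mx X^T C Bt.
Proof. by rewrite /pencil_mx tr_block_mx trmxK trmx0. Qed.

Lemma rank_pencil_tr n b c (X : 'M[K]_n) (Bt : 'M_(b, n)) (C : 'M_(c, n)) :
  \rank (pencil_mx X^T C Bt) = \rank (pencil_mx X Bt C).
Proof. by rewrite -tr_pencil mxrank_tr. Qed.

Lemma rank_pencil_leq n b b' c c' (X : 'M[K]_n) (Bt : 'M_(b, n)) (Bt' : 'M_(b', n))
    (C : 'M_(c, n)) (C' : 'M_(c', n)) :
  (Bt <= Bt')%MS -> (C <= C')%MS ->
  (\rank (pencil_mx X Bt C) <= \rank (pencil_mx X Bt' C'))%N.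
Proof.
move=> /submxP[u ->] /submxP[v ->].
have -> : pencil_mx X (u *m Bt') (v *m C')
    = block_mx 1%:M 0 0 v *m pencil_mx X Bt' C' *m block_mx 1%:M 0 0 u^T.
  rewrite /pencil_mx !mulmx_block !(mul1mx, mulmx1, mul0mx, mulmx0, addr0, add0r).
  by rewrite trmx_mul.
by rewrite (leq_trans (mxrankM_maxl _ _)) ?mxrankM_maxr.
Qed.

Lemma rank_pencil_eqmx n b b' c c' (X : 'M[K]_n) (Bt : 'M_(b, n)) (Bt' : 'M_(b', n))
    (C : 'M_(c, n)) (C' : 'M_(c', n)) :
  (Bt :=: Bt')%MS -> (C :=: C')%MS ->
  \rank (pencil_mx X Bt C) = \rank (pencil_mx X Bt' C').
Proof.
by move=> eB eC; apply/eqP; rewrite eqn_leq !rank_pencil_leq ?eB ?eC.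
Qed.

(** The added outputs become a separate block row, the shape that [one_channel] expects. *)
Lemma rank_pencil_adds n b c c' (X : 'M[K]_n) (Bt : 'M_(b, n))
    (C : 'M_(c, n)) (C' : 'M_(c', n)) :
  (\rank (pencil_mx X Bt (C + C')%MS)
   <= \rank (col_mx (pencil_mx X Bt C) (row_mx C' 0)))%N.
Proof.
apply: mxrankS; rewrite -[pencil_mx X Bt _]/(col_mx _ _) col_mx_sub.
have rE d (D : 'M[K]_(d, n)) : row_mx D 0 = D *m row_mx 1%:M (0 : 'M_(n, b)).
  by rewrite mul_mx_row mulmx1 mulmx0.
rewrite -!addsmxE -[pencil_mx X Bt C]/(col_mx (row_mx X Bt^T) (row_mx C 0)).
apply/andP; split.
  by apply: submx_trans (addsmxSl _ _); rewrite -addsmxE addsmxSl.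
rewrite (rE _ (C + C')%MS) (rE _ C) (rE _ C') addsmxMr addsmx_sub addsmxSr andbT.
by apply: submx_trans (addsmxSl _ _); rewrite -addsmxE addsmxSr.
Qed.

Lemma pencil_feedback n b c p q (X : 'M[K]_n) (Bt : 'M_(b, n)) (C : 'M_(c, n))
    (B' : 'M_(n, p)) (C' : 'M_(q, n)) G :
  pencil_mx (X + B' *m G *m C') Bt C
    = pencil_mx X Bt C + col_mx B' 0 *m G *m row_mx C' 0.
Proof.
rewrite mul_col_mx mul_col_row !mulmx0 !mul0mx /pencil_mx add_block_mx.
by rewrite !addr0.
Qed.

End Pencil.

(** * Generic rank under feedback in many channels *)

Section GenericFeedback.
Variables (F : numFieldType) (K : fieldType) (f : {rmorphism F -> K}).
Variables (I : finType) (n : nat) (p q : I -> nat).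
Variables (B : forall i, 'M[K]_(n, p i)) (C : forall i, 'M[K]_(q i, n)).

(** Induction on [#|T|]. For each [s] avoiding a chosen channel [i], the hypotheses at [i |: s] and
    at [s] are the two bounds of [one_channel]. One gain [G0] for channel [i] serves all these [s],
    and is absorbed into [X]. *)
Lemma generic_feedback (T : {set I}) r (X : 'M[K]_n) :
  (forall s : {set I}, s \subset T ->
     (r <= \rank (pencil_mx X (span_mx (tr_fam B) s) (span_mx C (T :\: s))))%N) ->
  exists G : forall i, 'M[F]_(p i, q i),
    (r <= \rank (X + \sum_(i in T) B i *m map_mx f (G i) *m C i)%R)%N.
Proof.
have [k] := ubnP #|T|; elim: k => // k IH in T X *; rewrite ltnS => Tk HT.
have [T0|[i Ti]] := set_0Vmem T.
  exists (fun=> 0); have := HT set0 (sub0set _).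
  rewrite T0 setD0 big_set0 addr0 !span_mx0 => /leq_trans; apply.
  by rewrite /pencil_mx trmx0 rank_diag_block_mx mxrank0 addn0.
pose T' := T :\ i; have T'k : (#|T'| < k)%N.
  by rewrite (leq_trans _ Tk) // [leqRHS](cardsD1 i) Ti.
pose M (s : {set I}) := pencil_mx X (span_mx (tr_fam B) s) (span_mx C (T' :\: s)).
have [s|G0 H0] := @common_feedback _ _ f _ (enum (powerset T')) (fun=> r) _ _ _ _ M
    (col_mx (B i) 0) (row_mx (C i) 0).
  rewrite mem_enum powersetE => sT'; apply: one_channel.
    (* Transposition turns the inputs of channel [i] into outputs, so that [rank_pencil_adds]
       applies to them. *)
    rewrite -mxrank_tr tr_row_mx tr_pencil tr_col_mx trmx0.
    apply: leq_trans (rank_pencil_adds _ _ _ _); rewrite -rank_pencil_tr trmxK.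
    have sT : i |: s \subset T.
      by rewrite subUset sub1set Ti (subset_trans sT') ?subsetDl.
    apply: leq_trans (HT _ sT) _; apply: rank_pencil_leq; first exact: span_mxU1.
    by rewrite /T' setDDl submx_refl.
  apply: leq_trans (rank_pencil_adds _ _ _ _).
  have sT : s \subset T by rewrite (subset_trans sT') ?subsetDl.
  apply: leq_trans (HT _ sT) _; apply: rank_pencil_leq; first exact: submx_refl.
  suff -> : T :\: s = i |: (T' :\: s) by exact: span_mxU1.
  apply/setP => j; rewrite !inE; case: eqP => //= ->; rewrite Ti andbT.
  by apply: contraTN sT' => si; apply/subsetPn; exists i; rewrite ?inE ?eqxx.
have [s sT'|G H] := IH T' (X + B i *m map_mx f G0 *m C i) T'k.
  by rewrite pencil_feedback; apply: H0; rewrite mem_enum powersetE.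
exists (dfwith G G0); apply: leq_trans H _.
rewrite [in leqRHS](big_setD1 i) // dfwith_in addrA.
rewrite [in leqRHS](eq_bigr (fun j => B j *m map_mx f (G j) *m C j)) // => j.
by rewrite !inE => /andP[ji _]; rewrite dfwith_out // eq_sym.
Qed.

End GenericFeedback.

(** * Pencils of direct sums and Schur complements *)

Section DirectSum.
Variable K : fieldType.

(** The permutation matrix that exchanges the two middle blocks. *)
Definition swap_mx a b c d : 'M[K]_((a + b) + (c + d), (a + c) + (b + d)) :=
  block_mx (block_mx 1%:M 0 0 0) (block_mx 0 0 1%:M 0)
           (block_mx 0 1%:M 0 0) (block_mx 0 0 0 1%:M).

Lemma swap_mxK a b c d : swap_mx a b c d *m swap_mx a c b d = 1%:M.
Proof.
rewrite /swap_mx !mulmx_block !(mul1mx, mulmx1, mul0mx, mulmx0) !add_block_mx.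
by rewrite !(addr0, add0r) !block_mx0 -!scalar_mx_block.
Qed.

Lemma rank_pencil_block n k b h c e (X : 'M[K]_n) (Y : 'M[K]_k)
    (Bt : 'M_(b, n)) (H : 'M_(h, k)) (C : 'M_(c, n)) (D : 'M_(e, k)) :
  \rank (pencil_mx (block_mx X 0 0 Y) (block_mx Bt 0 0 H) (block_mx C 0 0 D))
    = (\rank (pencil_mx X Bt C) + \rank (pencil_mx Y H D))%N.
Proof.
set M := pencil_mx _ _ _; rewrite -rank_diag_block_mx; set M' := block_mx _ _ _ _.
have MS : M *m swap_mx n k b h = swap_mx n k c e *m M'.
  rewrite /M /M' /pencil_mx /swap_mx tr_block_mx !trmx0 -(@block_mx0 K c e b h).
  rewrite !mulmx_block !(mul1mx, mulmx1, mul0mx, mulmx0) !add_block_mx.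
  by rewrite !(addr0, add0r, mul1mx, mulmx1, mul0mx, mulmx0).
have ME : M = swap_mx n k c e *m M' *m swap_mx n b k h.
  by rewrite -MS -mulmxA swap_mxK mulmx1.
have M'E : M' = swap_mx n c k e *m M *m swap_mx n k b h.
  by rewrite -mulmxA MS mulmxA swap_mxK mul1mx.
apply/eqP; rewrite eqn_leq; apply/andP; split.
  by rewrite ME (leq_trans (mxrankM_maxl _ _)) ?mxrankM_maxr.
by rewrite M'E (leq_trans (mxrankM_maxl _ _)) ?mxrankM_maxr.
Qed.

(** Block elimination by the unitriangular [L] and [U] leaves [Y] and minus the transfer matrix [Z]
    on the diagonal. *)
Lemma rank_pencil_unit k h e (Y : 'M[K]_k) (H : 'M_(h, k)) (D : 'M_(e, k)) :
  Y \in unitmx ->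
  \rank (pencil_mx Y H D) = (k + \rank (D *m invmx Y *m H^T))%N.
Proof.
move=> Yu; set Z := D *m _ *m _.
pose L := block_mx 1%:M 0 (D *m invmx Y) 1%:M : 'M[K]_(k + e).
pose U := block_mx 1%:M (invmx Y *m H^T) 0 1%:M : 'M[K]_(k + h).
have -> : pencil_mx Y H D = L *m block_mx Y 0 0 (- Z) *m U.
  rewrite /L /U /pencil_mx !mulmx_block.
  rewrite !(mul1mx, mulmx1, mul0mx, mulmx0, addr0, add0r) mulmxKV // mulmxA mulmxV //.
  by rewrite mul1mx -/Z mulmxA -/Z subrr.
have Lu : L \in unitmx by rewrite unitmxE det_lblock !det1 mulr1 unitr1.
have Uu : U \in unitmx by rewrite unitmxE det_ublock !det1 mulr1 unitr1.
rewrite mxrankMfree ?row_free_unit // -mxrank_tr trmx_mul mxrankMfree; last first.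
  by rewrite row_free_unit unitmx_tr.
by rewrite mxrank_tr rank_diag_block_mx mxrank_opp mxrank_unit.
Qed.

Lemma span_mx_block (I : finType) n k (q e : I -> nat)
    (C : forall i, 'M[K]_(q i, n)) (D : forall i, 'M[K]_(e i, k)) s :
  (span_mx (fun i => block_mx (C i) 0 0 (D i)) s
     :=: block_mx (span_mx C s) 0 0 (span_mx D s))%MS.
Proof.
have rE d (A : 'M[K]_(d, n)) : row_mx A 0 = A *m row_mx 1%:M (0 : 'M_(n, k)).
  by rewrite mul_mx_row mulmx1 mulmx0.
have rE' d (A : 'M[K]_(d, k)) : row_mx 0 A = A *m row_mx (0 : 'M_(k, n)) 1%:M.
  by rewrite mul_mx_row mulmx1 mulmx0.
apply/eqmxP/andP; split; last first.
  rewrite /block_mx col_mx_sub rE rE'.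
  apply/andP; split; apply: span_mxMr => i si; apply: span_mx_sup si _.
    by rewrite -rE -addsmxE addsmxSl.
  by rewrite -rE' -addsmxE addsmxSr.
apply/span_mx_subP => i si; rewrite /block_mx col_mx_sub.
apply/andP; split; rewrite -addsmxE.
  rewrite (rE _ (C i)) (rE _ (span_mx C s)).
  by apply: submx_trans (addsmxSl _ _); rewrite submxMr // (span_mx_sup si).
rewrite (rE' _ (D i)) (rE' _ (span_mx D s)).
by apply: submx_trans (addsmxSr _ _); rewrite submxMr // (span_mx_sup si).
Qed.

End DirectSum.

(** * Upper bounds on the closed-loop rank *)

Section ClosedLoop.
Variables (K : fieldType) (I : finType) (n : nat) (p q : I -> nat).
Variables (B : forall i, 'M[K]_(n, p i)) (C : forall i, 'M[K]_(q i, n)).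

(** Feedback terms with [i] in [s] have their columns in the span of the inputs of [s], the others
    their rows in the span of the outputs of [~: s]. The closed loop is thus a compression of the
    pencil. *)
Lemma closed_loop_rank_leq (X : 'M[K]_n) (G : forall i, 'M[K]_(p i, q i)) s :
  (\rank (X + \sum_i B i *m G i *m C i)%R
     <= \rank (pencil_mx X (span_mx (tr_fam B) s) (span_mx C (~: s))))%N.
Proof.
have /submxP[u uE] : ((\sum_(i in s) B i *m G i *m C i)%R^T <= span_mx (tr_fam B) s)%MS.
  rewrite linear_sum summx_sub // => i si; apply: span_mx_sup si _.
  by rewrite /= -mulmxA trmx_mul submxMl.
have /submxP[v vE] :
    ((\sum_(i in ~: s) B i *m G i *m C i)%R <= span_mx C (~: s))%MS.
  by rewrite summx_sub // => i si; apply: span_mx_sup si _; rewrite submxMl.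
have -> : X + \sum_i B i *m G i *m C i
    = row_mx 1%:M v *m pencil_mx X (span_mx (tr_fam B) s) (span_mx C (~: s))
        *m col_mx 1%:M u^T.
  rewrite /pencil_mx mul_row_block mul_row_col !mul1mx mulmx0 addr0 mulmx1 -vE.
  rewrite -trmx_mul -uE trmxK -addrA; congr (_ + _).
  rewrite (bigID (fun i => i \in s)) /= addrC; congr (_ + _).
  by apply: eq_bigl => i; rewrite inE.
by rewrite (leq_trans (mxrankM_maxl _ _)) ?mxrankM_maxr.
Qed.

Lemma eigenvalue_rank (g : 'M[K]_n) a : eigenvalue g a = (\rank (a%:M - g)%R < n)%N.
Proof.
rewrite -opprB mxrank_opp /eigenvalue /eigenspace kermx_eq0 /row_free.
by rewrite ltn_neqAle rank_leq_row andbT.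
Qed.

Lemma span_mxcol (s : {set I}) :
  (\mxcol_(k < #|s|) C (enum_val k) :=: span_mx C s)%MS.
Proof.
apply/eqmxP/andP; split.
  apply/row_subP => j; rewrite row_mxcol.
  by apply: span_mx_sup (enum_valP _) _; apply: row_sub.
apply/span_mx_subP => i si; rewrite -(enum_rankK_in si si).
rewrite -(mxcolK (fun k : 'I_#|s| => C (enum_val k))).
by apply/row_subP => j; rewrite row_rowsub row_sub.
Qed.

End ClosedLoop.

(** * Passage from real data to complex pencils *)

Section RealComplex.
Variable R : rcfType.

Lemma cmx_mxcol I (q : 'I_I -> nat) n (C : forall i, 'M[R]_(q i, n)) :
  cmx (\mxcol_i C i) = \mxcol_i cmx (C i).
Proof. by apply/matrixP => i j; rewrite !mxE. Qed.

Lemma cmx_tr a b (M : 'M[R]_(a, b)) : (cmx M)^T = cmx M^T.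
Proof. by rewrite /cmx map_trmx. Qed.

Lemma rank_test_pencil m n (A : 'M[R]_n) (p q : 'I_m -> nat)
    (B : forall i, 'M[R]_(n, p i)) (Cm : forall i, 'M[R]_(q i, n)) lam s :
  rank_test A B Cm lam s
    = \rank (pencil_mx (lam%:M - cmx A) (span_mx (tr_fam (fun i => cmx (B i))) s)
               (span_mx (fun i => cmx (Cm i)) (~: s))).
Proof.
rewrite -(rank_pencil_eqmx _ (span_mxcol _ _) (span_mxcol _ _)) /rank_test.
rewrite /pencil_mx /Bs /Cs cmx_mxcol tr_mxcol; congr (\rank (block_mx _ _ _ _)).
by apply/matrixP => i j; rewrite !mxE.
Qed.

End RealComplex.

(** * Resolvent and transfer blocks of the delay shifts *)

Section Shift.
Variable R : rcfType.
Variables (m : nat) (nbr : rel 'I_m) (d : 'I_m -> 'I_m -> nat) (nk : 'I_m -> nat).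
Local Notation H := (Hmx R nbr d nk).
Local Notation D := (dmax nbr d).
Local Notation Z := (Zext R nbr d nk).

Lemma shift_unit k r (lam : R[i]) :
  lam != 0 -> (lam%:M - cmx (shift_mx R k r)) \in unitmx.
Proof.
move=> lam0; rewrite unitmxE det_trig; last first.
  apply/is_trig_mxP => i j ij; rewrite !mxE -val_eqE /= (ltn_eqF ij) mulr0n sub0r.
  by rewrite ltn_eqF ?rmorph0 ?oppr0 // (leq_trans ij) ?leq_addr.
rewrite unitfE; apply/prodf_neq0 => i _; rewrite !mxE eqxx mulr1n.
(* An index [i] exists only if [r] is positive, and this keeps the shift off the diagonal. *)
have r0 : (0 < r)%N.
  case: r i => [[j]|//]; by rewrite muln0.
by rewrite (@ltn_eqF i) ?rmorph0 ?subr0 // -[ltnLHS]addn0 ltn_add2l.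
Qed.

Lemma cmx_mxdiag (q : 'I_m -> nat) (M : forall i, 'M[R]_(q i)) :
  cmx (\mxdiag_i M i) = \mxdiag_i cmx (M i).
Proof.
apply/matrixP => a b; rewrite !mxE.
move: (tagnat.sig1 a) (tagnat.sig2 a) (tagnat.sig1 b) (tagnat.sig2 b) => i x j y.
have [ij|_] := eqVneq i j; last by rewrite !mxE rmorph0.
by subst j; rewrite !conform_mx_id mxE.
Qed.

Lemma Zext_unit (lam : R[i]) : lam != 0 -> (lam%:M - cmx Z) \in unitmx.
Proof.
move=> lam0; rewrite cmx_mxdiag -mxdiagZ -mxdiagB -row_full_unit /row_full.
rewrite rank_mxdiag; apply/eqP; apply: eq_bigr => i _.
by rewrite mxrank_unit // shift_unit.
Qed.

Lemma Zext_mul_Hmx i e : Z *m H i e = H i e.+1.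
Proof.
rewrite /Zext /Hmx mul_mxdiag_mxcol; apply: eq_mxcol => k.
apply/matrixP => a b; rewrite !mxE.
under eq_bigr => c _ do rewrite !mxE.
have [ki|] := eqVneq k i; last by rewrite big1 // => c _; rewrite mulr0.
subst i; rewrite /=.
have shiftE c : (c == e * nk k + b)%N ->
    (a == c + nk k :> nat)%N = (a == e.+1 * nk k + b :> nat)%N.
  by move=> /eqP ->; rewrite mulSn addnAC [(nk k + _)%N]addnC addnAC.
(* At most the term [c = e * nk k + b] survives. It is in range whenever the row [a] it is sent to
   is; for any other row both sides are zero, so [e] needs no bound. *)
have [aE|ne] := eqVneq (a : nat) (e.+1 * nk k + b)%N.
  have hc : (e * nk k + b < blk nbr d nk k)%N.
    by apply: leq_ltn_trans (ltn_ord a); rewrite aE leq_add2r leq_mul2r leqnSn orbT.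
  rewrite (bigD1 (Ordinal hc)) //= big1 => [|c].
    by rewrite shiftE ?eqxx // aE eqxx mulr1 addr0.
  by rewrite -val_eqE /= => /negPf ->; rewrite mulr0.
rewrite big1 // => c _; case: (boolP (_ == _ * _ + _)%N) => [/shiftE->|_].
  by rewrite (negPf ne) mul0r.
by rewrite mulr0.
Qed.

Lemma Hmx_out i : H i (D i).+1 = 0.
Proof.
rewrite /Hmx -[RHS]mxcol0; apply: eq_mxcol => k.
apply/matrixP => a b; rewrite !mxE; case: eqVneq => //= ki; subst i.
by rewrite ltn_eqF // (leq_trans (ltn_ord a)) ?leq_addr.
Qed.

Lemma Hmx_tr_mul_neq k i e e' : k != i -> (H k e)^T *m H i e' = 0.
Proof.
move=> ki; rewrite /Hmx tr_mxcol mul_mxrow_mxcol big1 // => j _.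
apply/matrixP => a b; rewrite !mxE big1 // => c _; rewrite !mxE.
have [jk|_] := eqVneq j k; last by rewrite mul0r.
by subst j; rewrite (negPf ki) mulr0.
Qed.

Lemma Hmx_tr_mul k e e' : (e <= D k)%N -> (H k e)^T *m H k e' = (e == e')%:R%:M.
Proof.
move=> eD; rewrite /Hmx tr_mxcol mul_mxrow_mxcol (bigD1 k) //= [X in _ + X]big1.
  rewrite addr0; apply/matrixP => a b; rewrite !mxE.
  have ha : (e * nk k + a < blk nbr d nk k)%N.
    rewrite /blk (@leq_trans (e.+1 * nk k)%N) ?leq_mul2r ?ltnS ?eD ?orbT //.
    by rewrite mulSn addnC ltn_add2r.
  rewrite (bigD1 (Ordinal ha)) //= big1 => [|c]; last first.
    by rewrite !mxE eqxx -val_eqE /= => /negPf ->; rewrite mul0r.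
  rewrite !mxE !eqxx mul1r addr0 /=.
  have [->|ne] := eqVneq e e'; first by rewrite eqn_add2l val_eqE.
  (* Division by [nk k], positive because [a] is an index below it, recovers the block numbers [e]
     and [e']. *)
  rewrite mul0rn; case: eqP => // /(congr1 (fun x => x %/ nk k)%N).
  have k0 : (0 < nk k)%N by apply: leq_ltn_trans (ltn_ord a).
  by rewrite !divnMDl // !divn_small // !addn0 => /eqP; rewrite (negPf ne).
move=> j jk; apply/matrixP => a b; rewrite !mxE big1 // => c _.
by rewrite !mxE (negPf jk) mulr0.
Qed.

(* Neumann series: the shift maps [H i e] to [H i e.+1], and [H i (D i).+1 = 0]. *)
Definition resolvent_sol (lam : R[i]) i : 'M[R[i]]_(_, nk i) :=
  \sum_(e < (D i).+1) lam ^- e.+1 *: cmx (H i e).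

Lemma resolvent_solE (lam : R[i]) i :
  lam != 0 -> invmx (lam%:M - cmx Z) *m cmx (H i 0) = resolvent_sol lam i.
Proof.
move=> lam0; have Yu := Zext_unit lam0.
suff <- : (lam%:M - cmx Z) *m resolvent_sol lam i = cmx (H i 0) by rewrite mulKmx.
(* The terms of the product are differences of consecutive [u], so the sum telescopes to [u 0], the
   last [u] being zero by [Hmx_out]. *)
pose u e := lam ^- e *: cmx (H i e).
have uE e : (lam%:M - cmx Z) *m (lam ^- e.+1 *: cmx (H i e)) = - (u e.+1 - u e).
  have lamE : lam * lam ^- e.+1 = lam ^- e by rewrite exprS invfM mulVKf.
  by rewrite mulmxBl mul_scalar_mx scalerA lamE -scalemxAr -map_mxM Zext_mul_Hmx opprB.
rewrite mulmx_sumr; under eq_bigr => e _ do rewrite uE.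
rewrite sumrN.
rewrite -(big_mkord xpredT (fun e => u e.+1 - u e)) telescope_sumr //.
by rewrite /u Hmx_out [cmx 0]map_mx0 scaler0 sub0r opprK expr0 invr1 scale1r.
Qed.

Lemma transfer_neq (lam : R[i]) k i e : lam != 0 -> k != i ->
  (cmx (H k e))^T *m invmx (lam%:M - cmx Z) *m cmx (H i 0) = 0.
Proof.
move=> lam0 ki; rewrite -mulmxA resolvent_solE // mulmx_sumr big1 // => e' _.
by rewrite -scalemxAr cmx_tr -map_mxM Hmx_tr_mul_neq // map_mx0 scaler0.
Qed.

Lemma transfer_eq (lam : R[i]) k e : lam != 0 -> (e <= D k)%N ->
  (cmx (H k e))^T *m invmx (lam%:M - cmx Z) *m cmx (H k 0) = (lam ^- e.+1)%:M.
Proof.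
move=> lam0 eD; rewrite -mulmxA resolvent_solE // mulmx_sumr.
rewrite (bigD1 (Ordinal (eD : e < (D k).+1)%N)) //= big1 => [|e']; last first.
  rewrite -val_eqE /= eq_sym => /negPf ee'.
  by rewrite -scalemxAr cmx_tr -map_mxM Hmx_tr_mul // ee' raddf0 map_mx0 scaler0.
rewrite -scalemxAr cmx_tr -map_mxM Hmx_tr_mul // eqxx map_scalar_mx rmorph1.
by rewrite addr0 scale_scalar_mx mulr1.
Qed.

End Shift.

(** * The rank criterion for fixed eigenvalues *)

Section FixedEigenvalues.
Variables (R : rcfType) (m n : nat) (A : 'M[R]_n) (p q : 'I_m -> nat).
Variables (B : forall i, 'M[R]_(n, p i)) (Cm : forall i, 'M[R]_(q i, n)).

Lemma closed_loop_pencil (lam : R[i]) (G : forall i, 'M[R]_(p i, q i)) :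
  lam%:M - cmx (A + \sum_i B i *m G i *m Cm i)
    = lam%:M - cmx A + \sum_i cmx (B i) *m cmx (- G i) *m cmx (Cm i).
Proof.
rewrite /cmx map_mxD raddf_sum opprD addrA; congr (_ + _).
rewrite -sumrN; apply: eq_bigr => i _.
by rewrite /= !map_mxM map_mxN mulmxN mulNmx.
Qed.

Lemma fixed_eig_iff (lam : R[i]) :
  fixed_eig A B Cm lam <-> exists s, (rank_test A B Cm lam s < n)%N.
Proof.
split=> [fix_lam | [s rs] G]; last first.
  rewrite eigenvalue_rank closed_loop_pencil; apply: leq_ltn_trans rs.
  by rewrite rank_test_pencil closed_loop_rank_leq.
case: (pickP (fun s : {set 'I_m} => (rank_test A B Cm lam s < n)%N)) => [s|nos].
  by exists s.
have [s _|G rG] := @generic_feedback _ _ (real_complex R) _ _ _ _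
    (fun i => cmx (B i)) (fun i => cmx (Cm i)) setT n (lam%:M - cmx A).
  by rewrite setTD -rank_test_pencil leqNgt nos.
(* [generic_feedback] adds the feedback to [lam%:M - cmx A] while the closed loop subtracts it; the
   gain that moves [lam] is therefore [- G]. *)
have sumE :
    \sum_(i in [set: 'I_m]) cmx (B i) *m map_mx (real_complex R) (G i) *m cmx (Cm i)
      = \sum_i cmx (B i) *m cmx (- - G i) *m cmx (Cm i).
  by apply: eq_big => i; [rewrite inE | rewrite opprK].
move: rG; rewrite sumE -(closed_loop_pencil lam (fun i => - G i)) leqNgt.
by rewrite -eigenvalue_rank fix_lam.
Qed.

End FixedEigenvalues.

(** * Pencils of the extended system *)

Section Extended.
Variable R : rcfType.
Variables (m n : nat) (A : 'M[R]_n) (p q : 'I_m -> nat).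
Variables (B : forall i, 'M[R]_(n, p i)) (Cm : forall i, 'M[R]_(q i, n)).
Variables (nbr : rel 'I_m) (d : 'I_m -> 'I_m -> nat) (nk : 'I_m -> nat).
Local Notation H := (Hmx R nbr d nk).
Local Notation D := (dmax nbr d).
Local Notation Z := (Zext R nbr d nk).
Local Notation N := (Nz nbr d nk).

Definition relay_obs j : 'M[R]_(_, N) :=
  \mxcol_(k < #|Nset nbr j|) (H (enum_val k) (d (enum_val k) j))^T.

(** A square stand-in for [T_s]: inputs and outputs are replaced by matrices with the same spans,
    which preserves the rank. *)
Definition transfer_mx (lam : R[i]) s : 'M[R[i]]_N :=
  span_mx (fun j => cmx (relay_obs j)) (~: s) *m invmx (lam%:M - cmx Z)
    *m (span_mx (tr_fam (fun i => cmx (H i 0))) s)^T.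

Lemma rank_test_ext (lam : R[i]) s : lam != 0 ->
  rank_test (Aext nbr d nk A) (Bext nbr d nk B) (Cext nbr d nk Cm) lam s
    = (rank_test A B Cm lam s + (N + \rank (transfer_mx lam s)))%N.
Proof.
move=> lam0; rewrite !rank_test_pencil -rank_pencil_unit ?Zext_unit //.
rewrite -rank_pencil_block.
have -> : lam%:M - cmx (Aext nbr d nk A)
    = block_mx (lam%:M - cmx A) 0 0 (lam%:M - cmx Z).
  by rewrite /cmx map_block_mx !map_mx0 scalar_mx_block opp_block_mx add_block_mx
             !oppr0 !addr0.
apply: rank_pencil_eqmx.
  apply: eqmx_trans (span_mx_block _ _ _); apply/eqmxP.
  have E i : tr_fam (fun i => cmx (Bext nbr d nk B i)) i
     = block_mx (tr_fam (fun i => cmx (B i)) i) 0 0 (tr_fam (fun i => cmx (H i 0)) i).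
    by rewrite /tr_fam /cmx map_block_mx !map_mx0 tr_block_mx !trmx0.
  by rewrite /span_mx (eq_bigr _ (fun i _ => congr1 genmx (E i))) submx_refl.
apply: eqmx_trans (span_mx_block _ _ _); apply/eqmxP.
have E j : cmx (Cext nbr d nk Cm j) = block_mx (cmx (Cm j)) 0 0 (cmx (relay_obs j)).
  by rewrite /cmx map_col_mx !map_row_mx !map_mx0.
by rewrite /span_mx (eq_bigr _ (fun i _ => congr1 genmx (E i))) submx_refl.
Qed.

Lemma transfer_mx_eq0 (lam : R[i]) s : lam != 0 ->
  NsetS nbr (~: s) :&: s = set0 -> transfer_mx lam s = 0.
Proof.
move=> lam0 Ns; rewrite /transfer_mx -mulmxA; apply: span_mx_mul0 => j sj.
(* [span_mx_mul0] acts on a left factor only, so the input side is reached by transposing. *)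
apply: trmx_inj; rewrite mulmxA trmx_mul trmxK trmx0; apply: span_mx_mul0 => i si.
rewrite -trmx_mul cmx_mxcol !mxcol_mul -[RHS]trmx0; congr trmx.
rewrite -[RHS]mxcol0; apply: eq_mxcol => k; rewrite -cmx_tr transfer_neq //.
apply: contraTneq si => ki; apply/negP => si.
have := in_set0 i; rewrite -Ns inE si andbT => /negP[].
by apply/bigcupP; exists j; rewrite // -ki enum_valP.
Qed.

Lemma transfer_mx_rank (lam : R[i]) s k : lam != 0 ->
  k \in NsetS nbr (~: s) :&: s -> (nk k <= \rank (transfer_mx lam s))%N.
Proof.
move=> lam0; rewrite inE => /andP[/bigcupP[j sj jk] sk].
(* Agent [j] is a follower of [k], so its delay enters the maximum and the delayed state is still
   stored. *)
have kD : (d k j <= D k)%N by apply: leq_bigmax_cond; rewrite inE.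
have rk : \rank ((lam ^- (d k j).+1)%:M : 'M_(nk k)) = nk k.
  by rewrite -scalemx1 mxrank_scale_nz ?mxrank1 // invr_eq0 expf_neq0.
rewrite -{1}rk -(transfer_eq nk lam0 kD).
(* The invertible block of size [nk k] factors through [transfer_mx], since its output and input lie
   in the two spans. *)
have /submxP[u ->] : ((cmx (H k (d k j)))^T <= span_mx (fun j => cmx (relay_obs j)) (~: s))%MS.
  apply: span_mx_sup sj _; rewrite [cmx (relay_obs j)]cmx_mxcol.
  rewrite (span_mxcol (fun k => cmx (H k (d k j))^T)).
  by apply: span_mx_sup jk _; rewrite cmx_tr.
have /submxP[v vE] : ((cmx (H k 0))^T <= span_mx (tr_fam (fun i => cmx (H i 0))) s)%MS.
  exact: span_mx_sup sk _.
rewrite -[cmx (H k 0)]trmxK vE trmx_mul -!mulmxA.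
by rewrite (leq_trans (mxrankM_maxr _ _)) // !mulmxA mxrankM_maxl.
Qed.

End Extended.

Theorem theorem4 (R : rcfType) (m n : nat) (A : 'M[R]_n)
  (p q : 'I_m -> nat) (B : forall i, 'M[R]_(n, p i)) (Cm : forall i, 'M[R]_(q i, n))
  (nbr : rel 'I_m) (d : 'I_m -> 'I_m -> nat) (nk : 'I_m -> nat) :
  controllable A (\mxrow_(i < m) B i) ->
  observable (\mxcol_(i < m) Cm i) A ->
  weakly_connected nbr ->
  (forall i, d i i = 0%N) ->
  (forall (i : 'I_m) (s : {set 'I_m}) (lam : R[i]),
     eigenvalue (cmx A) lam -> (n - rank_test A B Cm lam s <= nk i)%N) ->
  forall lam : R[i], lam != 0 ->
    (~ fixed_eig (Aext nbr d nk A) (Bext nbr d nk B) (Cext nbr d nk Cm) lam <->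
     (forall s : {set 'I_m}, (rank_test A B Cm lam s < n)%N ->
        NsetS nbr (~: s) :&: s != set0)).
Proof.
move=> _ _ _ _ Hnk lam lam0.
rewrite (fixed_eig_iff _ _ _ lam); split.
  move=> nfix s rs; apply/negP => /eqP Ns; apply: nfix; exists s.
  by rewrite rank_test_ext // transfer_mx_eq0 // mxrank0 addn0 ltn_add2r.
move=> Hs [s]; rewrite rank_test_ext // ltnNge => /negP; apply.
have [rs|rs] := leqP n (rank_test A B Cm lam s).
  by rewrite leq_add // leq_addr.
have /set0Pn[k Nk] := Hs s rs.
(* [lam%:M - cmx A] is the pencil without inputs and outputs, so its rank is also below [n]; this
   makes the bound on [nk] available at [lam]. *)
have eA : eigenvalue (cmx A) lam.
  rewrite eigenvalue_rank; apply: leq_ltn_trans rs.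
  rewrite rank_test_pencil; apply: (@leq_trans (\rank (pencil_mx (lam%:M - cmx A)
     (0 : 'M_(0, n)) (0 : 'M_(0, n))))).
    by rewrite /pencil_mx trmx0 rank_diag_block_mx mxrank0 addn0.
  by rewrite rank_pencil_leq ?sub0mx.
(* What remains is that the rank deficiency of the original pencil is at most the rank of the
   transfer matrix; [nk k] lies between them. *)
rewrite addnCA [leqLHS]addnC leq_add2l -leq_subLR.
apply: leq_trans (Hnk k s lam eA) _.
exact: transfer_mx_rank.
Qed.
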